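(* Let $G\in\mathbb{R}^{N_y\times N_\theta}$, $y\in\mathbb{R}^{N_y}$, $r_0\in\mathbb{R}^{N_\theta}$, and let $\Sigma_\omega\in\mathbb{R}^{N_\theta\times N_\theta}$, $\Sigma_\nu\in\mathbb{R}^{N_y\times N_y}$ be symmetric with $\Sigma_\omega\succ 0$ and $\Sigma_\nu\succ 0$. Assume that either $\alpha\in(0,1)$, or $\alpha=1$ and $\mathrm{Range}(G^T)=\mathbb{R}^{N_\theta}$. Consider the iteration $(m_n,C_n)\mapsto(m_{n+1},C_{n+1})$, started from a vector $m_0\in\mathbb{R}^{N_\theta}$ and a covariance matrix $C_0$, given by $$\widehat m_{n+1}=\alpha m_n+(1-\alpha)r_0,\qquad \widehat C_{n+1}=\alpha^2C_n+\Sigma_\omega,$$ $$m_{n+1}=\widehat m_{n+1}+\widehat C_{n+1}G^T(G\widehat C_{n+1}G^T+\Sigma_\nu)^{-1}(y-G\widehat m_{n+1}),$$ $$C_{n+1}=\widehat C_{n+1}-\widehat C_{n+1}G^T(G\widehat C_{n+1}G^T+\Sigma_\nu)^{-1}G\widehat C_{n+1}.$$ Then the steady state equation of the covariance iteration, $$C_\infty^{-1}=G^T\Sigma_\nu^{-1}G+(\alpha^2C_\infty+\Sigma_\omega)^{-1},$$ has a unique solution $C_\infty\succ0$. The pair $(m_n,C_n)$ converges exponentially fast, as $n\to\infty$, to a limit $(m_\infty,C_\infty)$. Furthermore the limiting mean $m_\infty$ is the minimizer over $\theta\in\mathbb{R}^{N_\theta}$ of the Tikhonov regularized least squares functional $$\Phi_R(\theta):=\frac12\big\|\Sigma_\nu^{-\frac12}(y-G\theta)\big\|^2+\frac{1-\alpha}{2}\big\|\widehat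 C_\infty^{-\frac12}(\theta-r_0)\big\|^2,\qquad\text{where } \widehat C_\infty=\alpha^2C_\infty+\Sigma_\omega.$$
   Context: $A\succ0$ means that the symmetric matrix $A$ is strictly positive-definite, and $A\succeq 0$ that it is positive semi-definite. A covariance matrix is a symmetric positive semi-definite matrix. $\|\cdot\|$ is the Euclidean norm on vectors. ''Converges exponentially fast'' means that the distance to the limit (in any norm) is bounded by $K\rho^n$ for all $n$, for some $K<\infty$ and $\rho\in(0,1)$. *)

(* Defs.v *)
From mathcomp Require Import all_boot all_order all_algebra.
From mathcomp Require Import all_classical all_reals.

Set Implicit Arguments.
Unset Strict Implicit.
Unset Printing Implicit Defensive.

Import Order.TTheory GRing.Theory Num.Theory.
Local Open Scope classical_set_scope.
Local Open Scope ring_scope.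

Section Matrices.
Variable R : realType.

Definition l2norm n (v : 'cV[R]_n) : R := Num.sqrt (\sum_(i < n) v i 0 ^+ 2).

Definition posdefmx n (A : 'M[R]_n) : Prop :=
  A \is symmetricmx /\ forall x : 'cV[R]_n, x != 0 -> 0 < (x^T *m A *m x) 0 0.

Definition possemidefmx n (A : 'M[R]_n) : Prop :=
  A \is symmetricmx /\ forall x : 'cV[R]_n, 0 <= (x^T *m A *m x) 0 0.

(* The principal square root A^(1/2). A positive semi-definite A has exactly
   one positive semi-definite square root; the default value 0 is only taken
   when A is not positive semi-definite. *)
Definition sqrtmx n (A : 'M[R]_n) : 'M[R]_n :=
  xget 0 [set B | possemidefmx B /\ B *m B = A].

End Matrices.

Section ExponentialConvergence.
Variables (R : realType) (V : lmodType R).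

(* Nonnegativity of N follows from these three axioms. *)
Definition is_norm (N : V -> R) : Prop :=
  [/\ forall u v, N (u + v) <= N u + N v,
      forall (a : R) v, N (a *: v) = `|a| * N v
    & forall v, N v = 0 -> v = 0].

Definition exp_cvg (u : nat -> V) (l : V) : Prop :=
  forall N : V -> R, is_norm N ->
    exists K rho : R, 0 < rho < 1 /\ forall n, N (u n - l) <= K * rho ^+ n.

End ExponentialConvergence.

Section Kalman.
Variables (R : realType) (Ny Nt : nat).
Variables (G : 'M[R]_(Ny, Nt)) (y : 'cV[R]_Ny) (r0 : 'cV[R]_Nt).
Variables (Sw : 'M[R]_Nt) (Sv : 'M[R]_Ny) (alpha : R).

Definition predict_mean (m : 'cV[R]_Nt) : 'cV[R]_Nt :=
  alpha *: m + (1 - alpha) *: r0.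

Definition predict_cov (C : 'M[R]_Nt) : 'M[R]_Nt := alpha ^+ 2 *: C + Sw.

Definition kalman_gain (Chat : 'M[R]_Nt) : 'M[R]_(Nt, Ny) :=
  Chat *m G^T *m invmx (G *m Chat *m G^T + Sv).

Definition kalman_step (s : 'cV[R]_Nt * 'M[R]_Nt) : 'cV[R]_Nt * 'M[R]_Nt :=
  let mhat := predict_mean s.1 in
  let Chat := predict_cov s.2 in
  (mhat + kalman_gain Chat *m (y - G *m mhat),
   Chat - kalman_gain Chat *m G *m Chat).

Definition kalman_iter (m0 : 'cV[R]_Nt) (C0 : 'M[R]_Nt) (n : nat) :
    'cV[R]_Nt * 'M[R]_Nt :=
  iter n kalman_step (m0, C0).

Definition steady_state (C : 'M[R]_Nt) : Prop :=
  invmx C = G^T *m invmx Sv *m G + invmx (predict_cov C).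

Definition tikhonov (Chat : 'M[R]_Nt) (theta : 'cV[R]_Nt) : R :=
  1 / 2 * l2norm (invmx (sqrtmx Sv) *m (y - G *m theta)) ^+ 2
  + (1 - alpha) / 2 * l2norm (invmx (sqrtmx Chat) *m (theta - r0)) ^+ 2.

End Kalman.

Definition minimizer (R : realType) (T : Type) (f : T -> R) (x : T) : Prop :=
  forall t, f x <= f t.

(* Main.v *)
Require Import Defs.
From mathcomp Require Import all_boot all_order all_algebra.
From mathcomp Require Import all_classical all_reals.
From mathcomp Require Import ring lra.

Set Implicit Arguments.
Unset Strict Implicit.
Unset Printing Implicit Defensive.

Import Order.TTheory GRing.Theory Num.Theory.
Local Open Scope classical_set_scope.
Local Open Scope ring_scope.

(** Write [S := G^T Sv^-1 G] for the information carried by one observation.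
    By the Woodbury identity the covariance recursion is [C' = F C] with
    [F C := (S + (alpha^2 C + Sw)^-1)^-1]. Everything rests on the Loewner
    order: since inversion is antitone, [F] is monotone, and an inequality
    [A <= (1 + d) B] is sharpened to [F A <= (1 + (1 - c) d) F B] whenever
    [c (alpha^2 B + Sw) <= Sw], because the noise [Sw] is common to both
    predictions ([riccati_contract]). This is the contraction of the Thompson
    part metric, expressed without logarithms.

    The rate [c] is uniform along an orbit because orbits are bounded: some
    definite [B] satisfies [F B <= B], namely [Sw / (1 - alpha^2)] if
    [alpha < 1] and [S^-1] if [alpha = 1], and large multiples of it inherit the
    property ([kalman_supersolution], [iter_riccati_bounded]). Hence consecutive
    iterates approach each other geometrically, their entries converge, the
    limit is definite because [F C >= (S + Sw^-1)^-1], and it is the only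
    definite fixed point ([iter_riccati_cvg], [riccati_fixed_unique]).

    For the mean, let [m] solve the normal equation of the Tikhonov functional,
    whose Hessian [S + (1 - alpha) Chat^-1] is definite in both cases. It is
    also the fixed point of the limiting mean update ([kalman_limit_fixed]). The
    error [e_k := m_k - m] obeys
    [e_{k+1} = alpha C_{k+1} Chat_{k+1}^-1 e_k + (C_{k+1} - C_inf) w] with a
    fixed vector [w]. In the moving quadratic form [C_k^-1] the linear part
    contracts by the same mechanism as above ([error_contract]) and the forcing
    term decays geometrically, so the errors do too ([error_decay]).

    The functional is stated with principal square roots, whose existence needs
    an argument over the reals: a fixed point of a suitable Riccati map with
    scalar noise is, up to a shift, the square root of a prescribed definite
    matrix ([posdef_sqrt_ex]), so the same convergence theorem provides it. *)

(** * Geometrically decaying real sequences *)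

Section GeometricDecay.
Variable R : realType.
Implicit Types u v : nat -> R.

Definition geom_decay u : Prop :=
  exists K rho : R, 0 < rho < 1 /\ forall n, `|u n| <= K * rho ^+ n.

Lemma geom_decay_le u v (k : R) :
  0 <= k -> (forall n, `|u n| <= k * `|v n|) -> geom_decay v -> geom_decay u.
Proof.
move=> k0 uv [K [rho [rho01 vK]]]; exists (k * K), rho; split=> // n.
by rewrite (le_trans (uv n))// -mulrA ler_wpM2l.
Qed.

Lemma geom_decay_geom (rho : R) : 0 < rho < 1 -> geom_decay (fun n => rho ^+ n).
Proof.
move=> /[dup] rho01 /andP[r0 _]; exists 1, rho; split=> // n.
by rewrite mul1r ger0_norm// exprn_ge0// ltW.
Qed.

Lemma geom_decayZ (k : R) u : geom_decay u -> geom_decay (fun n => k * u n).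
Proof. by apply: (@geom_decay_le _ _ `|k|) => // n; rewrite normrM. Qed.

Lemma geom_decay0 : geom_decay (fun=> 0).
Proof.
by exists 0, (1 / 2); split=> [|n]; [lra | rewrite normr0 mul0r].
Qed.

Lemma geom_decayD u v :
  geom_decay u -> geom_decay v -> geom_decay (fun n => u n + v n).
Proof.
move=> [K [r [/andP[r0 r1] uK]]] [L [s [/andP[s0 s1] vL]]].
have K0 : 0 <= K by have := uK 0%N; rewrite expr0 mulr1; apply: le_trans.
have L0 : 0 <= L by have := vL 0%N; rewrite expr0 mulr1; apply: le_trans.
exists (K + L), (Num.max r s); split=> [|n].
  by rewrite lt_max r0 gt_max r1 s1.
rewrite mulrDl (le_trans (ler_normD _ _))// lerD//.
  rewrite (le_trans (uK n))// ler_wpM2l// lerXn2r ?nnegrE ?le_max ?lexx//.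
    exact: ltW.
  by rewrite (ltW r0).
rewrite (le_trans (vL n))// ler_wpM2l// lerXn2r ?nnegrE ?le_max ?lexx ?orbT//.
  exact: ltW.
by rewrite (ltW r0).
Qed.

Lemma geom_decay_sum (I : Type) (s : seq I) (u : I -> nat -> R) :
  (forall i, geom_decay (u i)) -> geom_decay (fun n => \sum_(i <- s) u i n).
Proof.
move=> su; elim: s => [|i s IH].
  by apply: geom_decay_le geom_decay0 => // n; rewrite big_nil normr0 mulr0.
apply: (@geom_decay_le _ _ 1) (geom_decayD (su i) IH) => // n.
by rewrite big_cons mul1r.
Qed.

Lemma geom_decay_norm u : geom_decay u -> geom_decay (fun n => `|u n|).
Proof. by apply: (@geom_decay_le _ _ 1) => // n; rewrite mul1r normr_id. Qed.

Lemma geom_decayS u : geom_decay u -> geom_decay (fun n => u n.+1).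
Proof.
move=> [K [rho [rho01 uK]]]; exists (K * rho), rho; split=> // n.
by rewrite -mulrA -exprS.
Qed.

Lemma geom_decay_behead u : geom_decay (fun n => u n.+1) -> geom_decay u.
Proof.
move=> [K [rho [/[dup] rho01 /andP[r0 r1] uK]]].
have K0 : 0 <= K by have := uK 0%N; rewrite expr0 mulr1; apply: le_trans.
exists (`|u 0%N| + K / rho), rho; split=> // -[|n].
  by rewrite expr0 mulr1 lerDl divr_ge0// ltW.
rewrite (le_trans (uK n))// mulrDl -[leLHS]add0r lerD//.
  by rewrite mulr_ge0// exprn_ge0// ltW.
by rewrite exprS mulrA divfK ?gt_eqF.
Qed.

Lemma geom_decay_sqr u : geom_decay u -> geom_decay (fun n => u n ^+ 2).
Proof.
move=> /[dup] ud [K [rho [/andP[r0 r1] uK]]].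
have K0 : 0 <= K by have := uK 0%N; rewrite expr0 mulr1; apply: le_trans.
apply: (@geom_decay_le _ _ K) ud => // n.
rewrite normrX expr2 ler_wpM2r// (le_trans (uK n))// ler_piMr//.
by rewrite exprn_ile1// ltW.
Qed.

Lemma geom_decay_sqrt u : geom_decay (fun n => u n ^+ 2) -> geom_decay u.
Proof.
move=> [K [rho [/andP[r0 r1] uK]]].
have K0 : 0 <= K by have := uK 0%N; rewrite expr0 mulr1; apply: le_trans.
exists (Num.sqrt K), (Num.sqrt rho); split=> [|n].
  by rewrite sqrtr_gt0 r0 -sqrtr1 ltr_sqrt.
have e0 : 0 <= Num.sqrt K * Num.sqrt rho ^+ n.
  by rewrite mulr_ge0 ?exprn_ge0 ?sqrtr_ge0.
rewrite -(@ler_pXn2r _ 2) ?nnegrE// exprMn -exprM mulnC exprM.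
by rewrite !sqr_sqrtr ?(ltW r0)// -normrX.
Qed.

(** Bernoulli's inequality makes the powers of [rho^-1] unbounded, so no
    positive number lies below every [K * rho ^+ n]. *)
Lemma geom_decay_le0 (x : R) u : (forall n, x <= u n) -> geom_decay u -> x <= 0.
Proof.
move=> xu [K [rho [/andP[r0 r1] uK]]]; rewrite leNgt; apply/negP => x0.
have xK n : x <= K * rho ^+ n.
  by rewrite (le_trans (xu n))// (le_trans (ler_norm _)).
pose h := rho^-1 - 1.
have h0 : 0 < h by rewrite subr_gt0 invf_gt1.
have bern n : 1 + n%:R * h <= rho^-1 ^+ n.
  elim: n => [|n IH]; first by rewrite mul0r addr0 expr0.
  have rE : rho^-1 = 1 + h by rewrite /h; ring.
  rewrite exprS (le_trans _ (ler_wpM2l _ IH)) ?invr_ge0 ?(ltW r0)//.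
  rewrite rE -natr1; have := mulr_ge0 (ler0n R n) (sqr_ge0 h); nra.
have [n nK] : exists n : nat, K / x < 1 + n%:R * h.
  exists (Num.truncn ((K / x) / h)).+1.
  rewrite (@lt_trans _ _ ((Num.truncn (K / x / h)).+1%:R * h)) ?ltrDr//.
  by rewrite -ltr_pdivrMr// truncnS_gt.
have := lt_le_trans nK (bern n).
rewrite ltr_pdivrMr// exprVn mulrC ltr_pdivlMr ?exprn_gt0//.
by rewrite ltNge xK.
Qed.

Lemma geom_decay_eq0 (x : R) : geom_decay (fun=> x) -> x = 0.
Proof.
move=> xd; apply/eqP; rewrite -normr_le0.
by apply: geom_decay_le0 (geom_decay_norm xd) => n.
Qed.

(** If [`|u n.+1 - u n| <= K * rho ^+ n] then, with [M := K / (1 - rho)],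
    [u n - M * rho ^+ n] increases and [u n + M * rho ^+ n] decreases, so the
    supremum of the former lies between them for every [n]. *)
Lemma geom_decay_cauchy u :
  geom_decay (fun n => u n.+1 - u n) ->
  exists l : R, geom_decay (fun n => u n - l).
Proof.
move=> [K [rho [/[dup] rho01 /andP[r0 r1] uK]]].
have K0 : 0 <= K by have := uK 0%N; rewrite expr0 mulr1; apply: le_trans.
pose M := K / (1 - rho).
have d0 : 0 < 1 - rho by rewrite subr_gt0.
have M0 : 0 <= M by rewrite divr_ge0// ltW.
have MK : M * (1 - rho) = K by rewrite divfK// gt_eqF.
pose lo n := u n - M * rho ^+ n; pose hi n := u n + M * rho ^+ n.
have Mr n : M * rho ^+ n - M * rho ^+ n.+1 = K * rho ^+ n.
  by rewrite -MK exprS; ring.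
have lo_incr n : lo n <= lo n.+1.
  by have := uK n; rewrite ler_norml /lo => /andP[+ _]; have := Mr n; lra.
have hi_decr n : hi n.+1 <= hi n.
  by have := uK n; rewrite ler_norml /hi => /andP[_]; have := Mr n; lra.
have lo_homo := homo_leq (@lexx _ R) (@le_trans _ R) lo_incr.
have hi_homo : {homo hi : m n / (m <= n)%N >-> n <= m}.
  by apply: homo_leq => // x z t zx tz; apply: le_trans zx.
have lohi m n : lo m <= hi n.
  apply: (le_trans (lo_homo _ _ (leq_maxl m n))).
  apply: (le_trans _ (hi_homo _ _ (leq_maxr m n))).
  have : 0 <= M * rho ^+ maxn m n by rewrite mulr_ge0// exprn_ge0// ltW.
  by rewrite /lo /hi; lra.
exists (sup (range lo)), M, rho; split=> // n.
have lol : lo n <= sup (range lo).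
  apply: ub_le_sup; last by exists n.
  by exists (hi 0%N) => _ [m _ <-].
have lhi : sup (range lo) <= hi n.
  by apply: ge_sup => [|_ [m _ <-]//]; exists (lo 0%N), 0%N.
by rewrite ler_norml; move: lol lhi; rewrite /lo /hi; lra.
Qed.

Lemma geom_decay_rec (r : R) (v w : nat -> R) : 0 <= r < 1 ->
    (forall n, 0 <= v n) -> (forall n, v n.+1 <= r * v n + w n) ->
  geom_decay w -> geom_decay v.
Proof.
move=> /andP[r0 r1] v0 vw [K [rho [/andP[p0 p1] wK]]].
have K0 : 0 <= K by have := wK 0%N; rewrite expr0 mulr1; apply: le_trans.
(* a rate strictly above r and at least rho absorbs the forcing term *)
pose s := Num.max rho ((1 + r) / 2).
have rs : r < s by rewrite lt_max; apply/orP; right; lra.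
have s0 : 0 < s by apply: le_lt_trans rs.
have s1 : s < 1 by rewrite gt_max p1; lra.
have ps : rho <= s by rewrite le_max lexx.
pose M := v 0%N + K / (s - r).
have sr0 : 0 < s - r by rewrite subr_gt0.
have M0 : 0 <= M by rewrite addr_ge0// divr_ge0// ltW.
have KM : K <= M * (s - r).
  by rewrite mulrDl divfK ?gt_eqF// lerDr mulr_ge0// ltW.
exists M, s; split=> [|n]; first by rewrite s0 s1.
rewrite ger0_norm//; elim: n => [|n IH].
  by rewrite expr0 mulr1 lerDl divr_ge0// ltW.
have sn0 : 0 <= s ^+ n by rewrite exprn_ge0// ltW.
have wn : w n <= K * s ^+ n.
  rewrite (le_trans (ler_norm _))// (le_trans (wK n))// ler_wpM2l//.
  by rewrite lerXn2r// nnegrE ltW.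
have rv : r * v n <= r * (M * s ^+ n) by rewrite ler_wpM2l.
have Ks : K * s ^+ n <= M * (s - r) * s ^+ n by rewrite ler_wpM2r.
by rewrite exprS (le_trans (vw n))//; lra.
Qed.

End GeometricDecay.

(** * Bilinear and quadratic forms *)

Section QuadraticForms.
Variable R : realType.

Definition bform m n (A : 'M[R]_(m, n)) (x : 'cV[R]_m) (z : 'cV[R]_n) : R :=
  (x^T *m A *m z) 0 0.

Definition qform n (A : 'M[R]_n) (x : 'cV[R]_n) : R := bform A x x.

Definition lemx n (A B : 'M[R]_n) : Prop := forall x, qform A x <= qform B x.

Lemma bformDm m n (A B : 'M[R]_(m, n)) x z :
  bform (A + B) x z = bform A x z + bform B x z.
Proof. by rewrite /bform mulmxDr mulmxDl mxE. Qed.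

Lemma bformZm m n k (A : 'M[R]_(m, n)) x z :
  bform (k *: A) x z = k * bform A x z.
Proof. by rewrite /bform -scalemxAr -scalemxAl mxE. Qed.

Lemma bformDl m n (A : 'M[R]_(m, n)) x x' z :
  bform A (x + x') z = bform A x z + bform A x' z.
Proof. by rewrite /bform linearD /= !mulmxDl mxE. Qed.

Lemma bformDr m n (A : 'M[R]_(m, n)) x z z' :
  bform A x (z + z') = bform A x z + bform A x z'.
Proof. by rewrite /bform mulmxDr mxE. Qed.

Lemma bformZl m n (A : 'M[R]_(m, n)) k x z :
  bform A (k *: x) z = k * bform A x z.
Proof. by rewrite /bform linearZ /= -!scalemxAl mxE. Qed.

Lemma bformZr m n (A : 'M[R]_(m, n)) k x z :
  bform A x (k *: z) = k * bform A x z.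
Proof. by rewrite /bform -scalemxAr mxE. Qed.

Lemma bform_tr m n (A : 'M[R]_(m, n)) x z : bform A^T z x = bform A x z.
Proof.
rewrite /bform (_ : z^T *m A^T *m x = (x^T *m A *m z)^T) ?mxE//.
by rewrite !trmx_mul trmxK mulmxA.
Qed.

Lemma bform_mulr m n p (A : 'M[R]_(m, n)) (P : 'M[R]_(n, p)) x z :
  bform A x (P *m z) = bform (A *m P) x z.
Proof. by rewrite /bform !mulmxA. Qed.

Lemma bform_mull m n p (A : 'M[R]_(m, n)) (P : 'M[R]_(m, p)) x z :
  bform A (P *m x) z = bform (P^T *m A) x z.
Proof. by rewrite /bform trmx_mul !mulmxA. Qed.

Lemma qformDm n (A B : 'M[R]_n) x : qform (A + B) x = qform A x + qform B x.
Proof. exact: bformDm. Qed.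

Lemma qformZm n k (A : 'M[R]_n) x : qform (k *: A) x = k * qform A x.
Proof. exact: bformZm. Qed.

Lemma qformBm n (A B : 'M[R]_n) x : qform (A - B) x = qform A x - qform B x.
Proof. by rewrite -scaleN1r qformDm qformZm mulN1r. Qed.

Lemma qformZ n (A : 'M[R]_n) k x : qform A (k *: x) = k ^+ 2 * qform A x.
Proof. by rewrite /qform bformZl bformZr mulrA. Qed.

Lemma qform0 n (A : 'M[R]_n) : qform A 0 = 0.
Proof. by rewrite -[X in qform A X](scale0r 0) qformZ expr0n mul0r. Qed.

Lemma qform_mul m n (A : 'M[R]_m) (P : 'M[R]_(m, n)) x :
  qform A (P *m x) = qform (P^T *m A *m P) x.
Proof. by rewrite /qform bform_mulr bform_mull !mulmxA. Qed.

Lemma qform1 n (x : 'cV[R]_n) : qform 1%:M x = \sum_i x i 0 ^+ 2.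
Proof.
rewrite /qform /bform mulmx1 mxE; apply: eq_bigr => i _.
by rewrite mxE expr2.
Qed.

Lemma qformE n (A : 'M[R]_n) x :
  qform A x = \sum_i \sum_j A i j * (x i 0 * x j 0).
Proof.
rewrite /qform /bform mxE; under eq_bigr => j _ do
  rewrite mxE mulr_suml.
rewrite exchange_big; apply: eq_bigr => i _; apply: eq_bigr => j _.
by rewrite mxE; ring.
Qed.

Lemma symmetricmxP n (A : 'M[R]_n) : A \is symmetricmx <-> A^T = A.
Proof.
split=> [/is_hermitianmxP|AT].
  by rewrite expr0 scale1r map_mx_id // => <-.
by apply/is_hermitianmxP; rewrite expr0 scale1r map_mx_id.
Qed.

Lemma qformD n (A : 'M[R]_n) x z : A^T = A ->
  qform A (x + z) = qform A x + 2 * bform A x z + qform A z.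
Proof.
move=> AT; rewrite /qform bformDl !bformDr -[bform A z x]bform_tr AT; ring.
Qed.

End QuadraticForms.

(** * Positive definite matrices and the Loewner order *)

Section LoewnerOrder.
Variables (R : realType) (n : nat).
Implicit Types A B : 'M[R]_n.

Lemma lemx_refl A : lemx A A.
Proof. by move=> x. Qed.

Lemma posdef_sym A : posdefmx A -> A^T = A.
Proof. by case=> /symmetricmxP. Qed.

Lemma posdef_gt0 A x : posdefmx A -> x != 0 -> 0 < qform A x.
Proof. by case=> _; apply. Qed.

Lemma possemidef_sym A : possemidefmx A -> A^T = A.
Proof. by case=> /symmetricmxP. Qed.

Lemma possemidef_ge0 A x : possemidefmx A -> 0 <= qform A x.
Proof. by case=> _; apply. Qed.

Lemma posdefI A : A^T = A -> (forall x, x != 0 -> 0 < qform A x) -> posdefmx A.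
Proof. by move=> /symmetricmxP AT A0; split. Qed.

Lemma possemidefI A : A^T = A -> (forall x, 0 <= qform A x) -> possemidefmx A.
Proof. by move=> /symmetricmxP AT A0; split. Qed.

Lemma posdef_semi A : posdefmx A -> possemidefmx A.
Proof.
move=> Apd; apply: (possemidefI (posdef_sym Apd)) => x.
by have [->|x0] := eqVneq x 0; [rewrite qform0 | exact/ltW/posdef_gt0].
Qed.

Lemma posdef_ge0 A x : posdefmx A -> 0 <= qform A x.
Proof. by move=> /posdef_semi/possemidef_ge0. Qed.

Lemma posdef_eq0 A x : posdefmx A -> qform A x <= 0 -> x = 0.
Proof.
move=> Apd; apply: contraTeq => x0; rewrite -ltNge; exact: posdef_gt0.
Qed.

Lemma posdefDr A B : posdefmx A -> possemidefmx B -> posdefmx (A + B).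
Proof.
move=> Apd Bsd; apply: posdefI => [|x x0].
  by rewrite linearD /= posdef_sym// possemidef_sym.
by rewrite qformDm ltr_pwDl ?posdef_gt0 ?possemidef_ge0.
Qed.

Lemma posdefDl A B : possemidefmx A -> posdefmx B -> posdefmx (A + B).
Proof. by rewrite addrC => Asd Bpd; apply: posdefDr. Qed.

Lemma posdefZ k A : 0 < k -> posdefmx A -> posdefmx (k *: A).
Proof.
move=> k0 Apd; apply: posdefI => [|x x0].
  by rewrite linearZ /= posdef_sym.
by rewrite qformZm mulr_gt0 ?posdef_gt0.
Qed.

Lemma possemidefZ k A : 0 <= k -> possemidefmx A -> possemidefmx (k *: A).
Proof.
move=> k0 Asd; apply: possemidefI => [|x].
  by rewrite linearZ /= possemidef_sym.
by rewrite qformZm mulr_ge0 ?possemidef_ge0.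
Qed.

Lemma posdef_ge A B : B^T = B -> posdefmx A -> lemx A B -> posdefmx B.
Proof.
move=> BT Apd AB; apply: (posdefI BT) => x x0.
exact: lt_le_trans (posdef_gt0 Apd x0) (AB x).
Qed.

Lemma qform1_gt0 (x : 'cV[R]_n) : x != 0 -> 0 < qform 1%:M x.
Proof.
rewrite qform1 lt0r; have s0 : 0 <= \sum_i x i 0 ^+ 2.
  by apply: sumr_ge0 => i _; apply: sqr_ge0.
rewrite s0 andbT; apply: contra => /eqP/psumr_eq0P s.
apply/eqP/matrixP => i j; rewrite ord1 mxE; apply/eqP.
by rewrite -sqrf_eq0 s// => k _; apply: sqr_ge0.
Qed.

Lemma posdef1 : posdefmx (1%:M : 'M[R]_n).
Proof. by apply: posdefI => [|x]; [rewrite trmx1 | exact: qform1_gt0]. Qed.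

Lemma posdef_unit A : posdefmx A -> A \in unitmx.
Proof.
move=> Apd; rewrite -row_free_unit; apply: inj_row_free => v vA.
rewrite -[v]trmxK [v^T](@posdef_eq0 A) ?trmx0//.
by rewrite /qform /bform trmxK vA mul0mx mxE.
Qed.

Lemma qform_inv A x : posdefmx A -> qform (invmx A) x = qform A (invmx A *m x).
Proof.
move=> Apd; rewrite qform_mul trmx_inv posdef_sym// mulVmx ?mul1mx//.
exact: posdef_unit.
Qed.

Lemma posdef_inv A : posdefmx A -> posdefmx (invmx A).
Proof.
move=> Apd; apply: posdefI => [|x x0]; first by rewrite trmx_inv posdef_sym.
rewrite qform_inv// posdef_gt0//; apply: contra x0 => /eqP Ax0.
by rewrite -[x](mulKVmx (posdef_unit Apd)) Ax0 mulmx0.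
Qed.

Lemma posdef_invZ (k : R) A : 0 < k -> posdefmx A ->
  invmx (k *: A) = k^-1 *: invmx A.
Proof. by move=> k0 Apd; rewrite invmxZ//; apply/posdef_unit/posdefZ. Qed.

(** Completing the square. Together with the next two lemmas this is Legendre
    duality: [qform (invmx A)] is the pointwise supremum over [z] of
    [2 * bform 1%:M x z - qform A z], so it is antitone in [A]. *)
Lemma qform_inv_gap A x z : posdefmx A ->
  qform A (z - invmx A *m x) =
  qform (invmx A) x - (2 * bform 1%:M x z - qform A z).
Proof.
move=> Apd; have Au := posdef_unit Apd.
rewrite -scaleN1r (qformD _ _ (posdef_sym Apd)) qformZ -qform_inv// bformZr.
by rewrite bform_mulr mulmxV// -[bform _ z x]bform_tr trmx1; ring.
Qed.

Lemma qform_inv_ge A x z :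
  posdefmx A -> 2 * bform 1%:M x z - qform A z <= qform (invmx A) x.
Proof.
move=> Apd; have := posdef_ge0 (z - invmx A *m x) Apd.
by rewrite qform_inv_gap// subr_ge0.
Qed.

Lemma qform_invE A x : posdefmx A ->
  2 * bform 1%:M x (invmx A *m x) - qform A (invmx A *m x) =
  qform (invmx A) x.
Proof.
by move=> Apd; rewrite -qform_inv// bform_mulr mul1mx /qform; ring.
Qed.

Lemma qform_young A (eta : R) x z : 0 < eta -> posdefmx A ->
  qform A (x + z) <= (1 + eta) * qform A x + (1 + eta^-1) * qform A z.
Proof.
move=> e0 Apd; have := posdef_ge0 (eta *: x + - 1 *: z) Apd.
rewrite !qformD ?posdef_sym// !qformZ bformZl bformZr.
rewrite -(pmulr_rge0 _ (_ : 0 < eta^-1)) ?invr_gt0// => h.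
have -> : 2 * bform A x z =
    eta * qform A x + eta^-1 * qform A z -
    eta^-1 * (eta ^+ 2 * qform A x + 2 * (eta * (- 1 * bform A x z)) +
      (- 1) ^+ 2 * qform A z) by field; rewrite gt_eqF.
lra.
Qed.

Lemma lemx_inv A B :
  posdefmx A -> posdefmx B -> lemx A B -> lemx (invmx B) (invmx A).
Proof.
move=> Apd Bpd AB x; rewrite -qform_invE//.
apply: le_trans (qform_inv_ge x (invmx B *m x) Apd).
rewrite lerD2l lerN2; exact: AB.
Qed.

Lemma lemx_anti A B : A^T = A -> B^T = B -> lemx A B -> lemx B A -> A = B.
Proof.
move=> AT BT AB BA; apply/eqP; rewrite -subr_eq0; apply/eqP.
have ABT : (A - B)^T = A - B by rewrite linearB /= AT BT.
have q0 x : qform (A - B) x = 0.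
  by apply/eqP; rewrite qformBm subr_eq0 eq_le AB BA.
apply/matrixP => i j; rewrite [RHS]mxE.
have := q0 (delta_mx i 0 + delta_mx j 0); rewrite qformD// !q0.
have -> : bform (A - B) (delta_mx i 0) (delta_mx j 0) = (A - B) i j.
  by rewrite /bform -colE trmx_delta -rowE !mxE.
lra.
Qed.

Definition entrynorm A : R := \sum_i \sum_j `|A i j|.

Lemma entrynorm_ge0 A : 0 <= entrynorm A.
Proof. by apply: sumr_ge0 => i _; apply: sumr_ge0. Qed.

Lemma qform1_ge_entry (x : 'cV[R]_n) i : x i 0 ^+ 2 <= qform 1%:M x.
Proof.
rewrite qform1 (bigD1 i)//= lerDl; apply: sumr_ge0 => j _; exact: sqr_ge0.
Qed.

Lemma qform_le_entrynorm A x : `|qform A x| <= entrynorm A * qform 1%:M x.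
Proof.
rewrite qformE mulr_suml (le_trans (ler_norm_sum _ _ _))//.
apply: ler_sum => i _; rewrite mulr_suml (le_trans (ler_norm_sum _ _ _))//.
apply: ler_sum => j _; rewrite normrM ler_wpM2l// ler_norml.
have := qform1_ge_entry x i; have := qform1_ge_entry x j.
have := sqr_ge0 (x i 0 + x j 0); have := sqr_ge0 (x i 0 - x j 0).
by move=> *; apply/andP; split; nra.
Qed.

(** Polarization: basis vectors have squared length 1 and the sum of two of them
    at most 4, whence the constant [(4 + 1 + 1) / 2]. *)
Lemma entry_le_qform A (eps : R) i j : A^T = A ->
  (forall x, `|qform A x| <= eps * qform 1%:M x) -> `|A i j| <= 3 * eps.
Proof.
move=> AT Ae.
have q1 k : qform (1%:M : 'M[R]_n) (delta_mx k 0) = 1.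
  by rewrite /qform /bform mulmx1 trmx_delta -rowE !mxE !eqxx.
have Aij : bform A (delta_mx i 0) (delta_mx j 0) = A i j.
  by rewrite /bform -mulmxA -colE trmx_delta -rowE !mxE.
have := Ae (delta_mx i 0); have := Ae (delta_mx j 0).
have := Ae (delta_mx i 0 + delta_mx j 0).
have := posdef_ge0 (delta_mx i 0 - delta_mx j 0) posdef1.
have e0 : 0 <= eps.
  by have := Ae (delta_mx i 0); rewrite q1 mulr1; apply: le_trans.
rewrite -scaleN1r !qformD ?trmx1// !qformZ !bformZr Aij !q1 !ler_norml.
set b := bform _ _ _ => b1 /andP[? ?] /andP[? ?] /andP[? ?].
have be : eps * b <= eps by nra.
by apply/andP; split; nra.
Qed.

(** With [k] bounding [qform (invmx B)] by the squared length, the duality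
    inequality at [z = k *: x] gives [k |x|^2 <= k^2 qform B x]: no minimization
    over the unit sphere is involved. *)
Lemma posdef_coercive B : posdefmx B ->
  exists k : R, 0 < k /\ forall x, qform 1%:M x <= k * qform B x.
Proof.
move=> Bpd.
have [k [k0 Ek]] : exists k : R, 0 < k /\ entrynorm (invmx B) = k - 1.
  exists (1 + entrynorm (invmx B)); split; last by ring.
  by rewrite ltr_pwDl ?entrynorm_ge0.
exists k; split=> // x; have := qform_inv_ge x (k *: x) Bpd.
have := qform_le_entrynorm (invmx B) x; rewrite ler_norml => /andP[_].
rewrite qformZ bformZr -/(qform _ x) => b1 b2.
rewrite -(ler_pM2l k0); have := posdef_ge0 x posdef1.
by move: b1 b2; rewrite Ek; nra.
Qed.

Lemma posdef_dominates A B : posdefmx B ->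
  exists k : R, 0 < k /\ forall x, `|qform A x| <= k * qform B x.
Proof.
move=> Bpd; have [k [k0 kB]] := posdef_coercive Bpd.
exists ((1 + entrynorm A) * k); split=> [|x].
  by rewrite mulr_gt0// ltr_pwDl ?entrynorm_ge0.
rewrite -mulrA (le_trans (qform_le_entrynorm A x))//.
rewrite (@le_trans _ _ (entrynorm A * (k * qform B x)))//.
  by rewrite ler_wpM2l ?entrynorm_ge0.
by rewrite ler_wpM2r ?lerDr// mulr_ge0 ?posdef_ge0// ltW.
Qed.

Lemma lemx_posdef_scale A B : posdefmx B ->
  exists k : R, 0 < k /\ lemx A ((1 + k) *: B).
Proof.
move=> Bpd; have [k [k0 kB]] := posdef_dominates A Bpd.
exists k; split=> // x; rewrite qformZm (le_trans (ler_norm _))//.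
rewrite (le_trans (kB x))// mulrDl mul1r lerDr; exact: posdef_ge0.
Qed.

Lemma geom_decay_entrynorm (E : nat -> 'M[R]_n) :
  (forall i j, geom_decay (fun m => E m i j)) ->
  geom_decay (fun m => entrynorm (E m)).
Proof.
by move=> Ed; do 2 (apply: geom_decay_sum => ?); apply/geom_decay_norm.
Qed.

Lemma geom_decay_qform (E : nat -> 'M[R]_n) x :
  (forall i j, geom_decay (fun m => E m i j)) ->
  geom_decay (fun m => qform (E m) x).
Proof.
move=> /geom_decay_entrynorm; apply: geom_decay_le (posdef_ge0 x posdef1) _.
move=> m; rewrite (ger0_norm (entrynorm_ge0 _)) mulrC.
exact: qform_le_entrynorm.
Qed.

End LoewnerOrder.

Lemma possemidef_congr (R : realType) m n (A : 'M[R]_m) (P : 'M[R]_(m, n)) :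
  possemidefmx A -> possemidefmx (P^T *m A *m P).
Proof.
move=> Asd; apply: possemidefI => [|x].
  by rewrite !trmx_mul trmxK possemidef_sym// mulmxA.
by rewrite -qform_mul possemidef_ge0.
Qed.

(** * The Riccati map *)

Section RiccatiMap.
Variables (R : realType) (n : nat) (a : R) (W S : 'M[R]_n).
Hypotheses (a0 : 0 <= a) (Wpd : posdefmx W) (Ssd : possemidefmx S).
Implicit Types A B C D L : 'M[R]_n.

(** The covariance recursion in information form. The parameters are abstract
    because the map serves twice: for the filter, with [a = alpha ^+ 2], and
    for the construction of square roots, with [a = 1]. *)
Definition riccati C : 'M[R]_n := invmx (S + invmx (a *: C + W)).

Lemma predict_posdef C : possemidefmx C -> posdefmx (a *: C + W).
Proof. by move=> Csd; apply: posdefDl Wpd; apply: possemidefZ. Qed.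

Lemma information_posdef C :
  possemidefmx C -> posdefmx (S + invmx (a *: C + W)).
Proof.
by move=> Csd; apply: posdefDl => //; apply/posdef_inv/predict_posdef.
Qed.

Lemma riccati_posdef C : possemidefmx C -> posdefmx (riccati C).
Proof. by move=> Csd; apply/posdef_inv/information_posdef. Qed.

Lemma iter_riccati_semi m C : possemidefmx C -> possemidefmx (iter m riccati C).
Proof.
by move=> Csd; elim: m => //= m IH; apply/posdef_semi/riccati_posdef.
Qed.

(** The added noise [W] pulls comparable covariances together: if [c] is the
    part of the prediction [a *: B + W] accounted for by [W], then only the
    remaining part [1 - c] of the excess [delta] survives prediction, and the
    correction step (two inversions around the addition of [S]) does not
    increase it. *)
Lemma riccati_contract (c delta : R) A B :
    0 <= c <= 1 -> 0 <= delta -> possemidefmx A -> possemidefmx B ->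
    lemx (c *: (a *: B + W)) W -> lemx A ((1 + delta) *: B) ->
  lemx (riccati A) ((1 + (1 - c) * delta) *: riccati B).
Proof.
move=> /andP[c0 c1] d0 Asd Bsd cW AB.
set mu := 1 + (1 - c) * delta.
have mu1 : 1 <= mu by rewrite lerDl mulr_ge0// subr_ge0.
have mu0 : 0 < mu by apply: lt_le_trans mu1.
have Bp := predict_posdef Bsd; have Ap := predict_posdef Asd.
have ABp : lemx (a *: A + W) (mu *: (a *: B + W)).
  move=> x; have := ler_wpM2l a0 (AB x); have := ler_wpM2l d0 (cW x).
  by rewrite !(qformDm, qformZm) /mu; lra.
have ABi : lemx (mu^-1 *: (S + invmx (a *: B + W))) (S + invmx (a *: A + W)).
  move=> x; have := lemx_inv Ap (posdefZ mu0 Bp) ABp x.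
  rewrite posdef_invZ// scalerDr !qformDm !qformZm => ABx; rewrite lerD//.
  by rewrite ler_piMl ?possemidef_ge0// invf_le1.
have := lemx_inv _ _ ABi; rewrite posdef_invZ ?invr_gt0// ?invrK; last first.
  exact: information_posdef.
apply; last exact: information_posdef.
by apply: posdefZ; rewrite ?invr_gt0//; apply: information_posdef.
Qed.

Lemma riccati_homo (delta : R) A B :
    0 <= delta -> possemidefmx A -> possemidefmx B ->
    lemx A ((1 + delta) *: B) ->
  lemx (riccati A) ((1 + delta) *: riccati B).
Proof.
move=> d0 Asd Bsd AB; rewrite -[delta in X in lemx _ X]mul1r -(subr0 1).
rewrite [X in X + _ * _]subr0.
apply: riccati_contract => //; first by rewrite lexx ler01.
by move=> x; rewrite scale0r /qform /bform mulmx0 mul0mx mxE posdef_ge0.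
Qed.

Lemma lemx_predict C : possemidefmx C -> lemx W (a *: C + W).
Proof.
move=> Csd x; by rewrite qformDm qformZm lerDr mulr_ge0// possemidef_ge0.
Qed.

(** A prediction is never sharper than [W], so the precision after an update is
    bounded whatever the starting covariance; this keeps limits definite. *)
Lemma information_le C : possemidefmx C ->
  lemx (S + invmx (a *: C + W)) (S + invmx W).
Proof.
move=> Csd x; rewrite !qformDm lerD2l.
exact: (lemx_inv Wpd (predict_posdef Csd) (lemx_predict Csd)).
Qed.

Lemma information_sup_posdef : posdefmx (S + invmx W).
Proof. exact: posdefDl (posdef_inv Wpd). Qed.

Lemma riccati_ge C : possemidefmx C -> lemx (invmx (S + invmx W)) (riccati C).
Proof.
move=> Csd; apply: lemx_inv (information_le Csd).
  exact: information_posdef.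
exact: information_sup_posdef.
Qed.

Lemma riccati_le_predict C : possemidefmx C -> lemx (riccati C) (a *: C + W).
Proof.
move=> Csd; have Cp := predict_posdef Csd.
rewrite -[X in lemx _ X]invmxK.
apply: lemx_inv; [exact: posdef_inv | exact: information_posdef|] => x.
by rewrite qformDm lerDr possemidef_ge0.
Qed.

Lemma riccati_le_inv C : possemidefmx C -> posdefmx S ->
  lemx (riccati C) (invmx S).
Proof.
move=> Csd Spd; apply: lemx_inv; [by []|exact: information_posdef|] => x.
by rewrite qformDm lerDl posdef_ge0//; apply/posdef_inv/predict_posdef.
Qed.

(** A positive multiple of a supersolution is again one as soon as the factor
    is at least 1, so some multiple dominates the whole orbit. *)
Lemma iter_riccati_bounded B C : posdefmx B -> lemx (riccati B) B ->
    possemidefmx C ->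
  exists T : 'M[R]_n, posdefmx T /\ forall m, lemx (iter m riccati C) T.
Proof.
move=> Bpd RB Csd; have [k [k0 CB]] := lemx_posdef_scale C Bpd.
exists ((1 + k) *: B); split=> [|m].
  by apply: posdefZ => //; rewrite addr_gt0.
elim: m => //= m IH.
have := riccati_homo (ltW k0) (iter_riccati_semi m Csd) (posdef_semi Bpd) IH.
move=> H x; apply: (le_trans (H x)); rewrite !qformZm ler_wpM2l//.
by rewrite addr_ge0// ltW.
Qed.

(** The contraction rate is uniform over covariances below a common bound. *)
Lemma noise_fraction T : possemidefmx T ->
  exists c : R, 0 < c < 1 /\
    forall B, lemx B T -> lemx (c *: (a *: B + W)) W.
Proof.
move=> Tsd; have [k [k0 TW]] := lemx_posdef_scale (a *: T + W) Wpd.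
have k10 : 0 < 1 + k by rewrite addr_gt0.
exists (1 + k)^-1; split=> [|B BT x].
  by rewrite invr_gt0 k10 invf_lt1// ltrDl.
rewrite qformZm ler_pdivrMl// -qformZm (le_trans _ (TW x))//.
by rewrite !qformDm !qformZm lerD2r ler_wpM2l.
Qed.

(** At fixed points the contraction can be iterated in place, which drives the
    comparison factor to 1. *)
Lemma riccati_fixed_le A B : posdefmx A -> posdefmx B ->
  riccati A = A -> riccati B = B -> lemx A B.
Proof.
move=> Apd Bpd RA RB x.
have Asd := posdef_semi Apd; have Bsd := posdef_semi Bpd.
have [c [/andP[c0 c1] cB]] := noise_fraction Bsd.
have [k [k0 AB]] := lemx_posdef_scale A Bpd.
have ABn m : lemx A ((1 + (1 - c) ^+ m * k) *: B).
  elim: m => [|m IH]; first by rewrite expr0 mul1r.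
  rewrite -RA -RB exprS -mulrA; apply: riccati_contract => //.
  - by rewrite (ltW c0) (ltW c1).
  - by rewrite mulr_ge0 ?exprn_ge0 ?subr_ge0 ?ltW.
  - exact/cB/lemx_refl.
rewrite -subr_le0; apply: (@geom_decay_le0 _ _
    (fun m => (k * qform B x) * (1 - c) ^+ m)) => [m|].
  by have := ABn m x; rewrite qformZm; lra.
by apply/geom_decayZ/geom_decay_geom; rewrite subr_gt0 c1 ltrBlDr ltrDl.
Qed.

Lemma riccati_fixed_unique A B : posdefmx A -> posdefmx B ->
  riccati A = A -> riccati B = B -> A = B.
Proof.
move=> Apd Bpd RA RB; apply: lemx_anti; rewrite ?posdef_sym//;
exact: riccati_fixed_le.
Qed.

(** The contraction makes consecutive iterates comparable up to a factor
    [1 + O((1 - c) ^+ m)]; the common upper bound of the orbit turns this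
    relative closeness into closeness of the entries. *)
Lemma iter_riccati_cauchy B C : posdefmx B -> lemx (riccati B) B ->
    possemidefmx C ->
  forall i j, geom_decay (fun m =>
    iter m.+2 riccati C i j - iter m.+1 riccati C i j).
Proof.
move=> Bpd RB Csd.
(* [C] may be singular; the iterates are definite from the first one on *)
pose D m := iter m.+1 riccati C.
have DR m : D m.+1 = riccati (D m) by [].
have Dpd m : posdefmx (D m) by apply: riccati_posdef; apply: iter_riccati_semi.
have Dsd m := posdef_semi (Dpd m).
have [T [Tpd CT]] := iter_riccati_bounded Bpd RB Csd.
have DT m : lemx (D m) T by apply: CT.
have [c [/andP[c0 c1] cT]] := noise_fraction (posdef_semi Tpd).
have [k [k0 D10]] := lemx_posdef_scale (D 1%N) (Dpd 0%N).
have [l [l0 D01]] := lemx_posdef_scale (D 0%N) (Dpd 1%N).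
have d0 p m : 0 < p -> 0 <= (1 - c) ^+ m * p.
  by move=> p0; rewrite mulr_ge0 ?exprn_ge0 ?subr_ge0 ?ltW.
have c01 : 0 <= c <= 1 by rewrite (ltW c0) (ltW c1).
have up m : lemx (D m.+1) ((1 + (1 - c) ^+ m * k) *: D m).
  elim: m => [|m IH]; first by rewrite expr0 mul1r.
  rewrite exprS -mulrA (DR m.+1) {2}DR.
  by apply: riccati_contract => //; [exact: d0 | exact/cT].
have down m : lemx (D m) ((1 + (1 - c) ^+ m * l) *: D m.+1).
  elim: m => [|m IH]; first by rewrite expr0 mul1r.
  rewrite exprS -mulrA (DR m.+1) {1}DR.
  by apply: riccati_contract => //; [exact: d0 | exact/cT].
have [t [t0 Tt]] := posdef_dominates T (posdef1 R n).
move=> i j; apply: (@geom_decay_le _ _ (fun m => (1 - c) ^+ m)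
  (3 * ((k + l) * t))); last 1 first.
- by apply: geom_decay_geom; rewrite subr_gt0 c1 ltrBlDr ltrDl.
- by rewrite !mulr_ge0// ?addr_ge0// ltW.
move=> m; have cm0 : 0 <= (1 - c) ^+ m by rewrite exprn_ge0// subr_ge0 ltW.
rewrite (ger0_norm cm0) -mulrA.
have -> : iter m.+2 riccati C i j - iter m.+1 riccati C i j =
    (D m.+1 - D m) i j by rewrite !mxE.
apply: entry_le_qform => [|x].
  by rewrite linearB /= !posdef_sym.
rewrite ler_norml qformBm.
have := up m x; have := down m x; rewrite !qformZm.
have := DT m x; have := DT m.+1 x.
have /(le_trans (ler_norm _)) := Tt x.
have := posdef_ge0 x (Dpd m); have := posdef_ge0 x (Dpd m.+1).
set e := (1 - c) ^+ m in cm0 *.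
move=> q1 q0 qT q1T q0T dn u.
have le0 : 0 <= e * l by rewrite mulr_ge0// ltW.
have ke0 : 0 <= e * k by rewrite mulr_ge0// ltW.
have h1 : e * k * qform (D m) x <= e * k * (t * qform 1%:M x).
  by rewrite ler_wpM2l// (le_trans q0T).
have h2 : e * l * qform (D m.+1) x <= e * l * (t * qform 1%:M x).
  by rewrite ler_wpM2l// (le_trans q1T).
have h3 : 0 <= e * k * (t * qform 1%:M x).
  by rewrite mulr_ge0// (le_trans _ (le_trans q0T qT)).
have h4 : 0 <= e * l * (t * qform 1%:M x).
  by rewrite mulr_ge0// (le_trans _ (le_trans q0T qT)).
by apply/andP; split; lra.
Qed.

(** Entrywise convergence to a limit bounded below turns into two-sided
    relative comparison [D m <= (1 + e m) L <= (1 + e m)^2 D m] with [e]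
    geometrically small, which [riccati] preserves; hence the limit is fixed. *)
Lemma iter_riccati_cvg B C : posdefmx B -> lemx (riccati B) B ->
    possemidefmx C ->
  exists L, [/\ posdefmx L, riccati L = L &
    forall i j, geom_decay (fun m => (iter m riccati C - L) i j)].
Proof.
move=> Bpd RB Csd.
(* [C] may be singular; the iterates are definite from the first one on *)
pose D m := iter m.+1 riccati C.
have Dpd m : posdefmx (D m) by apply: riccati_posdef; apply: iter_riccati_semi.
have [T [Tpd CT]] := iter_riccati_bounded Bpd RB Csd.
have cauchy i j : exists l : R, geom_decay (fun m => D m i j - l).
  apply: (@geom_decay_cauchy _ (fun m => D m i j)).
  exact: (iter_riccati_cauchy Bpd RB Csd).
have [L DL] : exists L : 'M[R]_n,
    forall i j, geom_decay (fun m => (D m - L) i j).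
  exists (\matrix_(i, j) projT1 (cid (cauchy i j))) => i j.
  have := projT2 (cid (cauchy i j)).
  by apply: (@geom_decay_le _ _ _ 1) => // m; rewrite mul1r !mxE.
have LT : L^T = L.
  apply/matrixP => i j; apply/eqP; rewrite mxE -subr_eq0; apply/eqP.
  apply: geom_decay_eq0.
  have := geom_decayD (DL i j) (geom_decayZ (-1) (DL j i)).
  apply: (@geom_decay_le _ _ _ 1) => // m.
  have DT : D m j i = D m i j by rewrite -[in LHS](posdef_sym (Dpd m)) mxE.
  rewrite mul1r (_ : L j i - L i j = (D m - L) i j + -1 * (D m - L) j i)//.
  by rewrite !mxE DT; ring.
have DLq x : geom_decay (fun m => qform (D m - L) x).
  exact: geom_decay_qform.
pose P := invmx (S + invmx W).
have Ppd : posdefmx P by apply/posdef_inv/information_sup_posdef.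
have PD m : lemx P (D m) by apply: riccati_ge; apply: iter_riccati_semi.
have PL : lemx P L.
  move=> x; rewrite -subr_le0; apply: geom_decay_le0 (DLq x) => m.
  by have := PD m x; rewrite qformBm; lra.
have Lpd : posdefmx L by apply: posdef_ge PL.
have Lsd := posdef_semi Lpd.
have [k [k0 Pk]] := posdef_coercive Ppd.
pose e m := entrynorm (D m - L) * k.
have e0 m : 0 <= e m by rewrite mulr_ge0 ?entrynorm_ge0// ltW.
have ed : geom_decay e.
  rewrite /e; have := geom_decayZ k (geom_decay_entrynorm DL).
  by apply: (@geom_decay_le _ _ _ 1) => // m; rewrite mul1r mulrC.
have DLe m x : `|qform (D m - L) x| <= e m * qform P x.
  rewrite -mulrA (le_trans (qform_le_entrynorm _ _))//.
  by rewrite ler_wpM2l ?entrynorm_ge0.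
have up m : lemx (D m) ((1 + e m) *: L).
  move=> x; have := DLe m x; have := ler_wpM2l (e0 m) (PL x).
  rewrite ler_norml qformBm qformZm => ? /andP[? ?]; lra.
have down m : lemx L ((1 + e m) *: D m).
  move=> x; have := DLe m x; have := ler_wpM2l (e0 m) (PD m x).
  rewrite ler_norml qformBm qformZm => ? /andP[? ?]; lra.
have RLpd : posdefmx (riccati L) by apply: riccati_posdef.
have RL : riccati L = L.
  apply: lemx_anti; rewrite ?posdef_sym// => x.
    rewrite -subr_le0; apply: (@geom_decay_le0 _ _ (fun m =>
        qform T x * e m + qform (D m.+1 - L) x)) => [m|]; last first.
      apply: geom_decayD; first exact: geom_decayZ.
      exact: (geom_decayS (DLq x)).
    have := riccati_homo (e0 m) Lsd (posdef_semi (Dpd m)) (down m) x.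
    rewrite qformZm qformBm; have := ler_wpM2l (e0 m) (CT m.+2 x).
    by rewrite /D /=; lra.
  rewrite -subr_le0; apply: (@geom_decay_le0 _ _ (fun m =>
      qform (riccati L) x * e m - qform (D m.+1 - L) x)) => [m|]; last first.
    apply: geom_decayD; first exact: geom_decayZ.
    apply: (@geom_decay_le _ _ (fun m => qform (D m.+1 - L) x) 1) => // [m|].
      by rewrite mul1r normrN.
    exact: (geom_decayS (DLq x)).
  have := riccati_homo (e0 m) (posdef_semi (Dpd m)) Lsd (up m) x.
  by rewrite qformZm qformBm /D /=; lra.
by exists L; split=> // i j; apply: geom_decay_behead.
Qed.

End RiccatiMap.

(** * Square roots and quadratic minimization *)

Section SquareRoot.
Variables (R : realType) (n : nat).

(** The fixed point [L] of [riccati 1 (2 v I) (invmx A)] satisfies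
    [L^-1 = A^-1 + (L + 2 v I)^-1], that is [(L + 2 v I) L = 2 v A]; so
    [L + v I] is a square root of [2 v A + v^2 I]. Every positive definite [T]
    has this form once [v] is small. *)
Lemma posdef_sqrt_ex (T : 'M[R]_n) : posdefmx T ->
  exists B, possemidefmx B /\ B *m B = T.
Proof.
move=> Tpd; have [k [k0 Tk]] := posdef_coercive Tpd.
pose v := Num.sqrt (2 * k)^-1.
have v0 : 0 < v by rewrite sqrtr_gt0 invr_gt0 mulr_gt0.
have v2 : v ^+ 2 = (2 * k)^-1 by rewrite sqr_sqrtr// invr_ge0 mulr_ge0// ltW.
have w0 : 0 < 2 * v by rewrite mulr_gt0.
have TT : T^T = T := posdef_sym Tpd.
pose A := (2 * v)^-1 *: (T - v ^+ 2 *: 1%:M).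
have Apd : posdefmx A.
  apply: posdefZ; first by rewrite invr_gt0.
  apply: posdefI => [|x x0]; first by rewrite linearB linearZ /= trmx1 TT.
  rewrite qformBm qformZm v2; have := Tk x; have := posdef_gt0 Tpd x0.
  rewrite subr_gt0 ltr_pdivrMl ?mulr_gt0// => q0 qk.
  by rewrite (le_lt_trans qk)// -mulrA [ltRHS]mulr_natl mulr2n ltrDl mulr_gt0.
pose W : 'M[R]_n := (2 * v) *: 1%:M.
have Wpd : posdefmx W by apply/posdefZ/posdef1.
have Spd := posdef_inv Apd.
have sup : lemx (riccati 1 W (invmx A) A) A.
  rewrite -[X in lemx _ X]invmxK; apply: riccati_le_inv => //.
  - exact: posdef_semi.
  - exact: posdef_semi.
have [L [Lpd RL _]] := iter_riccati_cvg ler01 Wpd (posdef_semi Spd) Apd sup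
  (posdef_semi Apd).
exists (L + v *: 1%:M); split.
  by apply/posdef_semi/posdefDr => //; apply/posdef_semi/posdefZ/posdef1.
have [Y YE] : exists Y, Y = L + W by exists (L + W).
have Yu : Y \in unitmx.
  by rewrite YE; apply/posdef_unit/posdefDr => //; apply: posdef_semi.
have Lu := posdef_unit Lpd; have Au := posdef_unit Apd.
have Li : invmx L = invmx A + invmx Y.
  by rewrite YE -{1}RL /riccati invmxK scale1r.
have YL : Y = (2 * v) *: (A *m invmx L).
  have : A *m invmx L *m Y = Y + A.
    by rewrite Li mulmxDr mulmxV// mulmxDl mul1mx mulmxKV.
  rewrite {1}YE mulmxDr mulmxKV// /W -scalemxAr mulmx1 addrC.
  by move/addIr.
have YLA : Y *m L = T - v ^+ 2 *: 1%:M.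
  by rewrite YL -scalemxAl mulmxKV// scalerA divff ?gt_eqF// scale1r.
have -> : T = Y *m L + v ^+ 2 *: 1%:M by rewrite YLA subrK.
rewrite YE /W !(mulmxDl, mulmxDr, =^~scalemxAl, =^~scalemxAr, mul1mx, mulmx1).
by rewrite mulrDl !mul1r scalerDl scalerA -expr2 !addrA.
Qed.

Lemma sqrtmxP (T : 'M[R]_n) : posdefmx T ->
  possemidefmx (sqrtmx T) /\ sqrtmx T *m sqrtmx T = T.
Proof. by move=> /posdef_sqrt_ex Tex; apply: xgetPex Tex. Qed.

Lemma l2norm_sqr (x : 'cV[R]_n) : l2norm x ^+ 2 = qform 1%:M x.
Proof. by rewrite qform1 sqr_sqrtr// sumr_ge0// => i _; apply: sqr_ge0. Qed.

Lemma l2norm_invsqrt (T : 'M[R]_n) x : posdefmx T ->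
  l2norm (invmx (sqrtmx T) *m x) ^+ 2 = qform (invmx T) x.
Proof.
move=> Tpd; have [Bsd BB] := sqrtmxP Tpd; set B := sqrtmx T in Bsd BB *.
have Bu : B \in unitmx.
  by have := posdef_unit Tpd; rewrite -BB unitmx_mul => /andP[].
rewrite l2norm_sqr qform_mul mulmx1 trmx_inv possemidef_sym//.
congr qform; rewrite -[LHS](mulmxK (posdef_unit Tpd)) -[X in _ *m X *m _]BB.
by rewrite !mulmxA mulmxKV// mulVmx// mul1mx.
Qed.

End SquareRoot.

Section Minimization.
Variables (R : realType) (n : nat).

Lemma unique_minimizer_quadratic (H : 'M[R]_n) b (c : R)
    (f : 'cV[R]_n -> R) : posdefmx H ->
    (forall x, f x = c - 2^-1 * (2 * bform 1%:M b x - qform H x)) ->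
  unique (minimizer f) (invmx H *m b).
Proof.
move=> Hpd fE; have min : minimizer f (invmx H *m b).
  move=> x; rewrite !fE qform_invE// lerD2l lerN2 ler_wpM2l ?invr_ge0//.
  exact: qform_inv_ge.
split=> // x /(_ (invmx H *m b)) xmin; apply/esym/eqP; rewrite -subr_eq0.
apply/eqP/(posdef_eq0 Hpd); rewrite qform_inv_gap//.
by move: xmin; rewrite !fE qform_invE//; lra.
Qed.

End Minimization.

(** * Information form of the Kalman gain and covariance *)

Section KalmanAlgebra.
Variables (R : realType) (p n : nat) (G : 'M[R]_(p, n)) (V : 'M[R]_p).
Hypothesis Vpd : posdefmx V.

Definition obs_information : 'M[R]_n := G^T *m invmx V *m G.

Lemma obs_information_semi : possemidefmx obs_information.
Proof. exact/possemidef_congr/posdef_semi/posdef_inv. Qed.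

(** If [G^T] is onto then [G] is injective: [x = G^T *m v] and [G *m x = 0] give
    [|x|^2 = v^T G x = 0]. *)
Lemma obs_information_posdef :
  range (fun v : 'cV[R]_p => G^T *m v) = [set: 'cV[R]_n] ->
  posdefmx obs_information.
Proof.
move=> Gsurj; apply: posdefI => [|x].
  exact/possemidef_sym/obs_information_semi.
rewrite -qform_mul => x0; apply: posdef_gt0; first exact: posdef_inv.
apply: contra x0 => /eqP Gx0.
have [v _ vx] : range (fun v : 'cV[R]_p => G^T *m v) x by rewrite Gsurj.
apply/eqP/(posdef_eq0 (posdef1 R n)).
by rewrite /qform -{1}vx bform_mull trmxK mulmx1 -[G]mul1mx -bform_mulr Gx0
  /bform mulmx0 mxE.
Qed.

Lemma innovation_unit (X : 'M[R]_n) : posdefmx X ->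
  G *m X *m G^T + V \in unitmx.
Proof.
move=> Xpd; apply/posdef_unit/posdefDl => //.
by have := possemidef_congr G^T (posdef_semi Xpd); rewrite trmxK.
Qed.

(** The gain [K] is defined by [K (G X G^T + V) = X G^T]; moving the first
    summand to the other side gives this identity, from which the information
    forms of the gain and of the covariance follow. *)
Lemma kalman_gain_mul (X : 'M[R]_n) : posdefmx X ->
  (X - kalman_gain G V X *m G *m X) *m G^T = kalman_gain G V X *m V.
Proof.
move=> Xpd; have Iu := innovation_unit Xpd.
have XG : X *m G^T = kalman_gain G V X *m (G *m X *m G^T + V).
  by rewrite mulmxKV.
by rewrite mulmxBl XG mulmxDr !mulmxA addrC addKr.
Qed.

Lemma kalman_gainE (X : 'M[R]_n) : posdefmx X ->
  kalman_gain G V X =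
  (X - kalman_gain G V X *m G *m X) *m G^T *m invmx V.
Proof.
by move=> Xpd; rewrite kalman_gain_mul// mulmxK//; apply: posdef_unit.
Qed.

(** The Sherman-Morrison-Woodbury identity. *)
Lemma kalman_covE (X : 'M[R]_n) : posdefmx X ->
  X - kalman_gain G V X *m G *m X = invmx (obs_information + invmx X).
Proof.
move=> Xpd; have Vu := posdef_unit Vpd; have Xu := posdef_unit Xpd.
have Hu : obs_information + invmx X \in unitmx.
  apply/posdef_unit/posdefDl; [exact: obs_information_semi|exact: posdef_inv].
rewrite -[LHS](mulmxK Hu) -[RHS]mul1mx; congr (_ *m _).
rewrite mulmxDr /obs_information !mulmxA kalman_gain_mul// mulmxK//.
by rewrite mulmxBl mulmxK// mulmxV// addrC subrK.
Qed.

End KalmanAlgebra.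

(** * Decay of the error of the mean *)

Section ErrorDynamics.
Variables (R : realType) (n : nat) (alpha : R) (W S : 'M[R]_n).
Hypotheses (a0 : 0 < alpha) (Wpd : posdefmx W) (Ssd : possemidefmx S).
Local Notation ric := (riccati (alpha ^+ 2) W S).
Let sq_ge0 : 0 <= alpha ^+ 2 := sqr_ge0 alpha.

(** Measuring errors by the inverse of the current covariance makes the
    transition matrix [alpha *: ric C *m Chat^-1], with [Chat] the predicted
    covariance, a contraction: correction gives [ric C <= Chat], and [W] makes
    [alpha^2 *: C <= (1 - c) *: Chat]. *)
Lemma error_contract (c : R) C e :
    0 < c < 1 -> posdefmx C -> lemx (c *: (alpha ^+ 2 *: C + W)) W ->
  qform (invmx (ric C)) (ric C *m (invmx (alpha ^+ 2 *: C + W) *m (alpha *: e)))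
    <= (1 - c) * qform (invmx C) e.
Proof.
move=> /andP[c0 c1] Cpd cW; have Csd := posdef_semi Cpd.
have Ppd := predict_posdef sq_ge0 Wpd Csd.
have Rpd := riccati_posdef sq_ge0 Wpd Ssd Csd.
set P := alpha ^+ 2 *: C + W in cW Ppd *.
have b0 : 0 < 1 - c by rewrite subr_gt0.
have s0 : 0 < alpha ^+ 2 by rewrite exprn_gt0.
have k0 : 0 < (1 - c) / alpha ^+ 2 by rewrite divr_gt0.
have CP : lemx C (((1 - c) / alpha ^+ 2) *: P).
  move=> x; have := cW x.
  have : qform P x = alpha ^+ 2 * qform C x + qform W x.
    by rewrite qformDm qformZm.
  rewrite !qformZm => cP PE.
  by rewrite [leRHS]mulrAC ler_pdivlMr//; lra.
have := qform_inv (invmx P *m (alpha *: e)) (posdef_inv Rpd).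
rewrite invmxK => <-.
apply: le_trans (riccati_le_predict sq_ge0 Wpd Ssd Csd _) _.
rewrite -/P -qform_inv// qformZ.
have := lemx_inv Cpd (posdefZ k0 Ppd) CP e.
rewrite posdef_invZ// qformZm invf_div => h.
by rewrite -ler_pdivrMl// mulrA [_^-1 * _]mulrC.
Qed.

(** The precisions along an orbit lie between [S + W^-1] and the inverse of an
    upper bound of the orbit, so the moving quadratic form is uniformly
    equivalent to the squared length. Hence the forcing term is geometrically
    small in it, and the decay of the form gives that of the entries. *)
Lemma error_decay (C L : 'M[R]_n) w (B : 'M[R]_n) (e : nat -> 'cV[R]_n) :
    posdefmx B -> lemx (ric B) B -> possemidefmx C ->
    (forall i j, geom_decay (fun m => (iter m ric C - L) i j)) ->
    (forall m, e m.+1 =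
      iter m.+1 ric C *m
        (invmx (alpha ^+ 2 *: iter m ric C + W) *m (alpha *: e m))
      + (iter m.+1 ric C - L) *m w) ->
  forall i, geom_decay (fun m => e m i 0).
Proof.
move=> Bpd RB Csd CL eS i; pose D m := iter m.+1 ric C.
have Dpd m : posdefmx (D m).
  by apply: riccati_posdef => //; apply: iter_riccati_semi.
have [T [Tpd CT]] := iter_riccati_bounded sq_ge0 Wpd Ssd Bpd RB Csd.
have [c [/[dup] c01 /andP[c0 c1] cT]] :=
  noise_fraction sq_ge0 Wpd (posdef_semi Tpd).
pose v m := qform (invmx (D m)) (e m.+1).
pose d m := (D m.+1 - L) *m w.
have [k [k0 Ik]] := posdef_dominates (S + invmx W) (posdef1 R n).
have vd : geom_decay v.
  (* the weight [c] in Young's inequality leaves the rate (1 + c) (1 - c) *)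
  apply: (@geom_decay_rec _ (1 - c ^+ 2) _
    (fun m => (1 + c^-1) * k * qform 1%:M (d m))) => [|m|m|].
  - by rewrite subr_ge0 ltrBlDr ltrDl exprn_gt0// expr_le1 ?ltW.
  - exact/posdef_ge0/posdef_inv.
  - rewrite /v eS -/(D m.+1) -/(d m).
    have Dm : D m.+1 = ric (D m) by [].
    apply: le_trans (qform_young _ _ c0 (posdef_inv (Dpd m.+1))) _.
    have := error_contract (e m.+1) c01 (Dpd m) (cT _ (CT m.+1)).
    rewrite -Dm => h; rewrite lerD//.
      have -> : 1 - c ^+ 2 = (1 + c) * (1 - c) by ring.
      by rewrite -mulrA ler_wpM2l// addr_ge0// ltW.
    rewrite -mulrA ler_wpM2l ?addr_ge0 ?invr_ge0 ?(ltW c0)//.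
    rewrite (le_trans _ (le_trans (ler_norm _) (Ik _)))//.
    rewrite Dm /riccati invmxK; apply: information_le => //.
    exact: posdef_semi.
  - apply: geom_decayZ; rewrite (_ : (fun m => _) =
      fun m => \sum_i d m i 0 ^+ 2); last by apply/funext => m; rewrite qform1.
    apply: geom_decay_sum => j; apply: geom_decay_sqr.
    rewrite (_ : (fun m => _) = fun m => \sum_l w l 0 * (D m.+1 - L) j l).
      apply: geom_decay_sum => l; apply: geom_decayZ.
      exact: (geom_decayS (geom_decayS (CL j l))).
    by apply/funext => m; rewrite mxE; apply: eq_bigr => l _; rewrite mulrC.
have [t [t0 Tt]] := posdef_coercive (posdef_inv Tpd).
apply/geom_decay_behead/geom_decay_sqrt.
apply: (@geom_decay_le _ _ v t) vd => [|m]; first exact: ltW.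
rewrite ger0_norm ?sqr_ge0// (le_trans (qform1_ge_entry _ _))//.
rewrite (le_trans (Tt _))// ler_wpM2l ?(ltW t0)//.
apply: (le_trans _ (ler_norm _)).
exact: (lemx_inv (Dpd m) Tpd (CT m.+1)).
Qed.

End ErrorDynamics.

(** * Exponential convergence from the decay of the entries *)

Section NormOnPairs.
Variables (R : realType) (p q : nat).

Lemma seminorm_entries (N : 'M[R]_(p, q) -> R) :
    (forall A B, N (A + B) <= N A + N B) ->
    (forall a A, N (a *: A) = `|a| * N A) ->
  forall A, N A <= \sum_i \sum_j N (delta_mx i j) * `|A i j|.
Proof.
move=> ND NZ A; have N0 : N 0 = 0 by rewrite -(scale0r 0) NZ normr0 mul0r.
have Nsum (I : Type) (s : seq I) (F : I -> 'M[R]_(p, q)) :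
    N (\sum_(i <- s) F i) <= \sum_(i <- s) N (F i).
  elim/big_ind2: _ => [|x1 x2 y1 y2 h1 h2|//]; first by rewrite N0.
  exact: le_trans (ND _ _) (lerD h1 h2).
rewrite [X in N X](matrix_sum_delta A) (le_trans (Nsum _ _ _))//.
apply: ler_sum => i _; rewrite (le_trans (Nsum _ _ _))//.
by apply: ler_sum => j _; rewrite NZ mulrC.
Qed.

End NormOnPairs.

(** A norm on pairs restricts to a seminorm on each factor, which is bounded by
    a weighted sum of the absolute values of the entries. *)
Lemma exp_cvg_entries (R : realType) n (s : nat -> 'cV[R]_n * 'M[R]_n) m C :
    (forall i, geom_decay (fun k => ((s k).1 - m) i 0)) ->
    (forall i j, geom_decay (fun k => ((s k).2 - C) i j)) ->
  exp_cvg s (m, C).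
Proof.
move=> sm sC N [ND NZ _].
pose u k := \sum_i \sum_j N (delta_mx i j, 0) * `|((s k).1 - m) i j|.
pose v k := \sum_i \sum_j N (0, delta_mx i j) * `|((s k).2 - C) i j|.
suff [K [rho [r01 uvK]]] : geom_decay (fun k => u k + v k).
  exists K, rho; split=> // k; apply: (le_trans _ (uvK k)).
  apply: (le_trans _ (ler_norm _)).
  have -> : s k - (m, C) = ((s k).1 - m, 0) + (0, (s k).2 - C).
    by case: (s k) => a b /=; congr pair; rewrite ?addr0 ?add0r.
  apply: (le_trans (ND _ _)); apply: lerD.
    apply: (@seminorm_entries _ _ _ (fun x => N (x, 0))) => [x z|c x].
      rewrite (_ : (x + z, 0) = (x, 0) + (z, 0)) ?ND//.
    by congr pair; rewrite addr0.
    by rewrite -NZ; congr (N _); congr pair; rewrite scaler0.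
  apply: (@seminorm_entries _ _ _ (fun x => N (0, x))) => [x z|c x].
    rewrite (_ : (0, x + z) = (0, x) + (0, z)) ?ND//.
    by congr pair; rewrite addr0.
  by rewrite -NZ; congr (N _); congr pair; rewrite scaler0.
apply: geom_decayD; do 2 (apply: geom_decay_sum => ?).
  by apply/geom_decayZ/geom_decay_norm; rewrite ord1.
exact/geom_decayZ/geom_decay_norm.
Qed.

(** * The stationary Kalman filter *)

Section KalmanFilter.
Variables (R : realType) (Ny Nt : nat).
Variables (G : 'M[R]_(Ny, Nt)) (y : 'cV[R]_Ny) (r0 : 'cV[R]_Nt).
Variables (Sw : 'M[R]_Nt) (Sv : 'M[R]_Ny) (alpha : R).
Hypotheses (Swpd : posdefmx Sw) (Svpd : posdefmx Sv).
Hypothesis halpha : 0 < alpha < 1 \/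
  alpha = 1 /\ range (fun v : 'cV[R]_Ny => G^T *m v) = [set: 'cV[R]_Nt].

Local Notation S := (obs_information G Sv).
Local Notation ric := (riccati (alpha ^+ 2) Sw S).
Let Ssd : possemidefmx S := obs_information_semi G Svpd.
Let sq_ge0 : 0 <= alpha ^+ 2 := sqr_ge0 alpha.

Lemma kalman_alpha_gt0 : 0 < alpha.
Proof. by case: halpha => [/andP[]|[->]]. Qed.

(** For [alpha < 1] forgetting bounds the covariance even without data; for
    [alpha = 1] the observations determine every direction, and a covariance
    after correction never exceeds the inverse of their information. *)
Lemma kalman_supersolution : exists B, posdefmx B /\ lemx (ric B) B.
Proof.
case: halpha => [/andP[a0 a1]|[a1 Gsurj]].
  have a21 : 0 < 1 - alpha ^+ 2 by rewrite subr_gt0 expr_lt1// ltW.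
  have Bpd : posdefmx ((1 - alpha ^+ 2)^-1 *: Sw).
    by apply: posdefZ; rewrite ?invr_gt0.
  exists ((1 - alpha ^+ 2)^-1 *: Sw); split=> // x.
  apply: le_trans (riccati_le_predict sq_ge0 Swpd Ssd (posdef_semi Bpd) x) _.
  rewrite qformDm !qformZm le_eqVlt; apply/orP; left; apply/eqP.
  by field; rewrite gt_eqF.
have Spd := obs_information_posdef Svpd Gsurj.
exists (invmx S); split; first exact: posdef_inv.
by apply: riccati_le_inv => //; apply/posdef_semi/posdef_inv.
Qed.

Lemma steady_stateP C : posdefmx C ->
  steady_state G Sw Sv alpha C <-> ric C = C.
Proof.
move=> Cpd; rewrite /steady_state /riccati; split=> [<-|CE].
  exact: invmxK.
by rewrite -[in LHS]CE invmxK.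
Qed.

Lemma kalman_step_cov s : possemidefmx s.2 ->
  (kalman_step G y r0 Sw Sv alpha s).2 = ric s.2.
Proof. by move=> sd; apply: kalman_covE => //; apply: predict_posdef. Qed.

Lemma kalman_iter_cov m0 C0 k : possemidefmx C0 ->
  (kalman_iter G y r0 Sw Sv alpha m0 C0 k).2 = iter k ric C0.
Proof.
move=> C0sd; elim: k => //= k IH.
by rewrite -IH -kalman_step_cov// IH; apply: iter_riccati_semi.
Qed.

Lemma kalman_step_mean s : possemidefmx s.2 ->
  let mhat := predict_mean r0 alpha s.1 in
  (kalman_step G y r0 Sw Sv alpha s).1 =
  mhat + ric s.2 *m G^T *m invmx Sv *m (y - G *m mhat).
Proof.
move=> sd /=; have Ppd := predict_posdef sq_ge0 Swpd sd.
by rewrite /kalman_step /= (kalman_gainE _ Svpd Ppd) kalman_covE.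
Qed.

Lemma predict_meanE m :
  predict_mean r0 alpha m = m - (1 - alpha) *: (m - r0).
Proof. by apply/matrixP => i j; rewrite !mxE; ring. Qed.

Section Limit.
Variable L : 'M[R]_Nt.
Hypotheses (Lpd : posdefmx L) (RL : ric L = L).
Let Lhat := predict_cov Sw alpha L.

Let Lhat_pd : posdefmx Lhat.
Proof. exact/predict_posdef/posdef_semi. Qed.

Definition tikhonov_hess : 'M[R]_Nt := S + (1 - alpha) *: invmx Lhat.
Definition tikhonov_lin : 'cV[R]_Nt :=
  G^T *m invmx Sv *m y + (1 - alpha) *: (invmx Lhat *m r0).
Definition kalman_limit_mean : 'cV[R]_Nt := invmx tikhonov_hess *m tikhonov_lin.

Lemma tikhonov_hess_posdef : posdefmx tikhonov_hess.
Proof.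
case: halpha => [/andP[a0 a1]|[a1 Gsurj]].
  by apply: posdefDl => //; apply/posdefZ/posdef_inv => //; rewrite subr_gt0.
by rewrite /tikhonov_hess a1 subrr scale0r addr0; apply: obs_information_posdef.
Qed.

Lemma tikhonov_unique_minimizer :
  unique (minimizer (tikhonov G y r0 Sv alpha Lhat)) kalman_limit_mean.
Proof.
pose c := 2^-1 * qform (invmx Sv) y
  + (1 - alpha) / 2 * qform (invmx Lhat) r0.
apply: (@unique_minimizer_quadratic _ _ _ _ c) tikhonov_hess_posdef _ => x.
have ST : (invmx Sv)^T = invmx Sv by apply/posdef_sym/posdef_inv.
have LT : (invmx Lhat)^T = invmx Lhat by apply/posdef_sym/posdef_inv.
rewrite /tikhonov !l2norm_invsqrt// -scaleN1r -[x - r0]addrC -scaleN1r.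
rewrite !qformD// !qformZ bformZl bformZr qform_mul -/S.
have -> : bform 1%:M tikhonov_lin x =
    bform (invmx Sv) y (G *m x) + (1 - alpha) * bform (invmx Lhat) r0 x.
  rewrite bformDl bformZl; congr (_ + _ * _).
    by rewrite -mulmxA !bform_mull trmxK ST mulmx1 bform_mulr.
  by rewrite bform_mull LT mulmx1.
by rewrite /c qformDm qformZm -/S; field.
Qed.

Let mhat := predict_mean r0 alpha kalman_limit_mean.
Let w : 'cV[R]_Nt := G^T *m invmx Sv *m (y - G *m mhat).

(** The normal equation of the functional is, after multiplication by the
    precision [invmx L], the fixed point equation of the mean update. *)
Lemma kalman_limit_fixed : kalman_limit_mean = mhat + L *m w.
Proof.
set m := kalman_limit_mean.
have Hm : tikhonov_hess *m m = tikhonov_lin.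
  by rewrite mulKVmx//; apply/posdef_unit/tikhonov_hess_posdef.
pose g := (1 - alpha) *: (m - r0).
have mg : mhat = m - g by apply: predict_meanE.
have gE : invmx Lhat *m g = G^T *m invmx Sv *m y - S *m m.
  apply/eqP; rewrite eq_sym subr_eq -scalemxAr mulmxBr scalerBr addrAC.
  rewrite eq_sym subr_eq addrC scalemxAl -mulmxDl; exact/eqP.
have Lg : invmx L *m g = w.
  have -> : invmx L = S + invmx Lhat by rewrite -[in LHS]RL invmxK.
  rewrite mulmxDl gE /w mg !mulmxBr !mulmxA -/S opprB; exact: addrCA.
by rewrite -Lg mulKVmx ?posdef_unit// mg subrK.
Qed.

Lemma kalman_mean_decay m0 C0 : possemidefmx C0 ->
    (forall i j, geom_decay (fun k => (iter k ric C0 - L) i j)) ->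
  forall i, geom_decay (fun k =>
    ((kalman_iter G y r0 Sw Sv alpha m0 C0 k).1 - kalman_limit_mean) i 0).
Proof.
move=> C0sd CL; have [B [Bpd RB]] := kalman_supersolution.
apply: (error_decay kalman_alpha_gt0 Swpd Ssd Bpd RB C0sd CL (w := w)) => k.
set m := kalman_limit_mean; pose s := kalman_iter G y r0 Sw Sv alpha m0 C0 k.
have s2 : s.2 = iter k ric C0 by apply: kalman_iter_cov.
have Csd : possemidefmx s.2 by rewrite s2; apply: iter_riccati_semi.
rewrite -/s -[kalman_iter _ _ _ _ _ _ _ _ k.+1]/(kalman_step _ _ _ _ _ _ s).
rewrite kalman_step_mean// [iter k.+1 _ _]iterS -s2.
have Ppd := predict_posdef sq_ge0 Swpd Csd.
have Ru : invmx (ric s.2) \in unitmx.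
  by rewrite invmxK; apply/posdef_unit/information_posdef.
set C' := ric s.2 in Ru *; set P := _ + Sw in Ppd *.
have CS : C' *m invmx P = 1%:M - C' *m S.
  apply/(canRL (addrK _)); rewrite addrC -mulmxDr mulVmx//.
  exact/posdef_unit/information_posdef.
have mE : predict_mean r0 alpha s.1 = mhat + alpha *: (s.1 - m).
  by rewrite /mhat /predict_mean -/m scalerBr addrAC [_ + (_ - _)]addrC subrK.
rewrite mE [X in _ - X]kalman_limit_fixed.
rewrite [C' *m (_ *m _)]mulmxA CS mulmxBl mul1mx.
set e := alpha *: _; rewrite mulmxBl.
have -> : C' *m G^T *m invmx Sv *m (y - G *m (mhat + e)) =
    C' *m w - C' *m S *m e.
  by rewrite [G *m (_ + _)]mulmxDr opprD addrA mulmxBr /w !mulmxA.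
move: e mhat (C' *m w) (C' *m S *m e) (L *m w) => e h p q r.
by apply/matrixP => i j; rewrite !mxE; ring.
Qed.

End Limit.
End KalmanFilter.

Theorem theorem1 (R : realType) (Ny Nt : nat)
    (G : 'M[R]_(Ny, Nt)) (y : 'cV[R]_Ny) (r0 : 'cV[R]_Nt)
    (Sw : 'M[R]_Nt) (Sv : 'M[R]_Ny) (alpha : R)
    (m0 : 'cV[R]_Nt) (C0 : 'M[R]_Nt)
    (hSw : posdefmx Sw) (hSv : posdefmx Sv)
    (halpha : 0 < alpha < 1 \/
       alpha = 1 /\ range (fun v : 'cV[R]_Ny => G^T *m v) = [set: 'cV[R]_Nt])
    (hC0 : possemidefmx C0) :
  exists C_inf : 'M[R]_Nt,
    unique (fun C => posdefmx C /\ steady_state G Sw Sv alpha C) C_inf /\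
    exists m_inf : 'cV[R]_Nt,
      exp_cvg (kalman_iter G y r0 Sw Sv alpha m0 C0) (m_inf, C_inf) /\
      unique (minimizer
        (tikhonov G y r0 Sv alpha (predict_cov Sw alpha C_inf))) m_inf.
Proof.
have [B [Bpd RB]] := kalman_supersolution hSw hSv halpha.
have Ssd := obs_information_semi G hSv.
have [L [Lpd RL CL]] :=
  iter_riccati_cvg (sqr_ge0 alpha) hSw Ssd Bpd RB hC0.
exists L; split.
  split=> [|C [Cpd /(steady_stateP _ _ _ _ Cpd) RC]].
    by split=> //; apply/steady_stateP.
  exact: (riccati_fixed_unique (sqr_ge0 alpha) hSw Ssd).
exists (kalman_limit_mean G y r0 Sw Sv alpha L); split.
  apply: exp_cvg_entries => [|i j].
    exact: (kalman_mean_decay y r0 hSw hSv halpha Lpd RL).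
  rewrite (_ : (fun k => _) = fun k =>
    (iter k (riccati (alpha ^+ 2) Sw (obs_information G Sv)) C0 - L) i j) //.
  by apply/funext => k; rewrite kalman_iter_cov.
exact: tikhonov_unique_minimizer.
Qed.
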